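(* Let $a < b$ be real numbers, let $\alpha > 0$ with $\alpha \notin \mathbb{N}$, and let $f \in C^\ell[a,b]$ with some $\ell \in \mathbb{N}_0$. Let $n = \lceil \alpha \rceil$ and $c_\alpha = \frac{\sin \pi\alpha}{\pi} \prod_{j=1}^{n-1} \frac{1}{j-\alpha}$. Let $\psi : \Omega \to (0,\infty)$ be an admissible transformation, and for $t \in [a,b]$, $\omega \in \Omega$ let $$\phi(t,\omega) = c_\alpha\, \psi'(\omega)\, (\psi(\omega))^{n-\alpha-1} \int_a^t (t-\tau)^{n-1} \exp(-(t-\tau)\psi(\omega))\, f(\tau)\, \mathrm{d}\tau .$$ Then, for any $\omega \in \Omega$, $\phi(\cdot,\omega) \in C^{\ell+n}[a,b]$.
   Context: A function $\psi : \Omega \to (0,\infty)$ is called an admissible transformation if: (i) its domain $\Omega$ is a non-empty open interval of $\mathbb{R}$ (possibly unbounded); (ii) $\psi \in C^1(\Omega)$; (iii) $\psi$ is strictly monotonically increasing; (iv) $\lim_{\omega \to \inf\Omega} \psi(\omega) = 0$ and $\lim_{\omega \to \sup\Omega} \psi(\omega) = +\infty$. Here $\mathbb{N} = \{1,2,3,\ldots\}$, $\mathbb{N}_0 = \{0,1,2,\ldots\}$, $C^0[a,b] = C[a,b]$, and an empty product equals $1$. Derivatives at the endpoints of $[a,b]$ are one-sided. *)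

(* Defs.v *)
(* Stdlib real numbers with Coquelicot. *)
From Stdlib Require Import Reals List ZArith Zfloor.
From Coquelicot Require Import Coquelicot.
Import ListNotations.
Open Scope R_scope.

(* Functions on an interval are represented by total functions [R -> R] whose
   values outside the interval are irrelevant. *)

Definition cc (a b : R) : R -> Prop := fun x => a <= x <= b.

(* [continue_in] and [D_in] only look at points of [cc a b], so continuity and
   derivatives at the endpoints are one-sided. *)
Fixpoint Ck_on (k : nat) (a b : R) (f : R -> R) : Prop :=
  match k with
  | O => forall x, cc a b x -> continue_in f (cc a b) x
  | S k' => exists f' : R -> R,
      (forall x, cc a b x -> D_in f f' (cc a b) x) /\ Ck_on k' a b f'
  end.

Definition open_interval (Omega : R -> Prop) : Prop :=
  open Omega /\ is_connected Omega.

(* [Glb_Rbar] and [Lub_Rbar] are extended reals, which covers bounded and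
   unbounded [Omega]. *)
Record admissible (Omega : R -> Prop) (psi : R -> R) : Prop := {
  adm_nonempty : exists w, Omega w;
  adm_interval : open_interval Omega;
  adm_pos : forall w, Omega w -> 0 < psi w;
  adm_derivable : forall w, Omega w -> ex_derive psi w;
  adm_C1 : forall w, Omega w -> continuous (Derive psi) w;
  adm_incr : forall v w, Omega v -> Omega w -> v < w -> psi v < psi w;
  adm_lim_inf :
    filterlim psi (within Omega (Rbar_locally (Glb_Rbar Omega)))
      (Rbar_locally 0);
  adm_lim_sup :
    filterlim psi (within Omega (Rbar_locally (Lub_Rbar Omega)))
      (Rbar_locally p_infty)
}.

Definition nceil (alpha : R) : nat := Z.to_nat (Zceil alpha).

(* [seq 1 (n - 1)] is the list 1, ..., n - 1. *)
Definition c_coef (alpha : R) : R :=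
  sin (PI * alpha) / PI *
  fold_right Rmult 1
    (map (fun j : nat => 1 / (INR j - alpha)) (seq 1 (nceil alpha - 1))).

Definition phi (a alpha : R) (psi f : R -> R) (t w : R) : R :=
  let n := nceil alpha in
  c_coef alpha * Derive psi w * Rpower (psi w) (INR n - alpha - 1) *
  RInt (fun tau => (t - tau) ^ (n - 1) * exp (- (t - tau) * psi w) * f tau) a t.

(* Main.v *)
Require Import Defs.
From Stdlib Require Import Reals Lra Lia Zfloor.
From Coquelicot Require Import Coquelicot.
Open Scope R_scope.

(** Write [s = psi w] and [n = nceil alpha].  Since
    [exp (- (t - tau) * s) = exp (- s * t) * exp (s * tau)], the function
    [phi a alpha psi f t w] is a constant times [exp (- s * t)] times the
    iterated-integral operator
    [K_m h (t) = RInt (fun tau => (t - tau) ^ m * h tau) a t],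
    with [m = n - 1] and [h tau = exp (s * tau) * f tau].  The derivative of
    [K_0 h] is [h], and that of [K_(m+1) h] is [(m+1) * K_m h]
    ([is_derive_RInt_conv_pow]), so [K_m] gains [m + 1 = n] orders of
    smoothness ([Ck_on_RInt_conv_pow]).  Multiplication by the smooth functions
    [exp (s * t)] and [exp (- s * t)] preserves the class [Ck_on]
    ([Ck_on_mult], [Ck_on_exp]), so [phi] is of class [l + n] whenever [f] is of
    class [l].

    The hypotheses constrain [f] on [a, b] only, whereas differentiating an
    integral at the endpoints is simplest with an integrand continuous on a
    neighbourhood.  The integrand is therefore first extended continuously to
    the whole line by composing it with the projection onto [a, b]. *)

(** * Calculus of the classes C^k on a closed interval *)

Lemma D_in_ext_cc (a b : R) (f g f' g' : R -> R) (x : R) :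
  (forall y, cc a b y -> f y = g y) -> f' x = g' x -> cc a b x ->
  D_in f f' (cc a b) x -> D_in g g' (cc a b) x.
Proof.
  intros E E' Hx H eps He.
  destruct (H eps He) as [d [Hd H']].
  exists d; split; [exact Hd|].
  intros y [Hy Hd']. rewrite <- E', <- (E x Hx), <- (E y (proj1 Hy)).
  now apply H'.
Qed.

Lemma Ck_on_ext (k : nat) (a b : R) (f g : R -> R) :
  (forall x, cc a b x -> f x = g x) -> Ck_on k a b f -> Ck_on k a b g.
Proof.
  intros E; destruct k as [|k]; simpl.
  - intros H x Hx eps He.
    destruct (H x Hx eps He) as [d [Hd H']].
    exists d; split; [exact Hd|].
    intros y [Hy Hd']. rewrite <- (E x Hx), <- (E y (proj1 Hy)).
    now apply H'.
  - intros [f' [H1 H2]]; exists f'; split; [|exact H2].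
    intros x Hx. apply (D_in_ext_cc a b f g f' f'); auto.
Qed.

Lemma Ck_on_S (k : nat) (a b : R) (f : R -> R) :
  Ck_on (S k) a b f -> Ck_on k a b f.
Proof.
  revert f; induction k as [|k IH]; intros f [f' [H1 H2]].
  - intros x Hx. apply (cont_deriv f f'), H1, Hx.
  - exists f'; split; [exact H1 | exact (IH f' H2)].
Qed.

Lemma Ck_on_le (k m : nat) (a b : R) (f : R -> R) :
  (k <= m)%nat -> Ck_on m a b f -> Ck_on k a b f.
Proof. induction 1; auto using Ck_on_S. Qed.

Lemma Ck_on_plus (k : nat) (a b : R) (f g : R -> R) :
  Ck_on k a b f -> Ck_on k a b g -> Ck_on k a b (fun x => f x + g x).
Proof.
  revert f g; induction k as [|k IH]; intros f g.
  - intros Hf Hg x Hx. now apply limit_plus; [apply Hf | apply Hg].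
  - intros [f' [F1 F2]] [g' [G1 G2]].
    exists (fun x => f' x + g' x); split; [|now apply IH].
    intros x Hx. apply Dadd; auto.
Qed.

Lemma Ck_on_mult (k : nat) (a b : R) (f g : R -> R) :
  Ck_on k a b f -> Ck_on k a b g -> Ck_on k a b (fun x => f x * g x).
Proof.
  revert f g; induction k as [|k IH]; intros f g Hf Hg.
  - intros x Hx. now apply limit_mul; [apply Hf | apply Hg].
  - pose proof (Ck_on_S _ _ _ _ Hf) as Hf0.
    pose proof (Ck_on_S _ _ _ _ Hg) as Hg0.
    destruct Hf as [f' [F1 F2]]; destruct Hg as [g' [G1 G2]].
    exists (fun x => f' x * g x + f x * g' x); split.
    + intros x Hx. apply Dmult; auto.
    + apply Ck_on_plus; now apply IH.
Qed.

Lemma D_in_of_is_derive (a b : R) (f f' : R -> R) (x : R) :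
  is_derive f x (f' x) -> D_in f f' (cc a b) x.
Proof.
  intros H%is_derive_Reals%derivable_pt_lim_D_in.
  refine (limit1_imp _ _ _ _ _ _ H).
  intros y [_ Hy]; split; [exact I | exact Hy].
Qed.

Lemma Ck_on_const (k : nat) (a b c : R) : Ck_on k a b (fun _ => c).
Proof.
  revert c; induction k as [|k IH]; intros c.
  - intros x Hx. exact (limit_free (fun _ => c) _ x x).
  - exists (fun _ => 0); split; [|apply IH].
    intros x Hx. apply Dconst.
Qed.

Lemma Ck_on_exp (k : nat) (a b s : R) : Ck_on k a b (fun x => exp (s * x)).
Proof.
  assert (D : forall x, D_in (fun x => exp (s * x)) (fun x => s * exp (s * x))
                          (cc a b) x).
  { intros x. apply D_in_of_is_derive. auto_derive; [easy | ring]. }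
  induction k as [|k IH].
  - intros x _. exact (cont_deriv _ _ _ _ (D x)).
  - exists (fun x => s * exp (s * x)); split; [auto|].
    apply Ck_on_mult; [apply Ck_on_const | exact IH].
Qed.

(** * Continuous extension from a closed interval to the line *)

Definition clamp (a b x : R) : R := Rmax a (Rmin b x).

Lemma clamp_in (a b x : R) : a <= b -> cc a b (clamp a b x).
Proof. unfold cc, clamp, Rmax, Rmin; repeat destruct Rle_dec; lra. Qed.

Lemma clamp_id (a b x : R) : cc a b x -> clamp a b x = x.
Proof. unfold cc, clamp, Rmax, Rmin; repeat destruct Rle_dec; lra. Qed.

Lemma clamp_contract (a b x y : R) :
  a <= b -> Rabs (clamp a b y - clamp a b x) <= Rabs (y - x).
Proof.
  unfold clamp, Rmax, Rmin; intros.
  repeat destruct Rle_dec; unfold Rabs; repeat destruct Rcase_abs; lra.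
Qed.

(** One-sided continuity at the endpoints suffices here, since the composite
    only evaluates [f] on [a, b] and [clamp] does not increase distances. *)
Lemma continuous_comp_clamp (a b : R) (f : R -> R) :
  a <= b -> Ck_on 0 a b f -> forall x, continuous (fun y => f (clamp a b y)) x.
Proof.
  intros hab Hf x. apply continuity_pt_filterlim.
  intros eps He.
  destruct (Hf _ (clamp_in a b x hab) eps He) as [d [Hd H]].
  exists d; split; [exact Hd|].
  intros y [_ Hy]. simpl in *; unfold Rdist in *.
  (* [continue_in] only speaks of points distinct from the limit point. *)
  destruct (Req_dec (clamp a b x) (clamp a b y)) as [E|E].
  - rewrite E, Rminus_diag, Rabs_R0. lra.
  - apply H. repeat split; try apply clamp_in; auto.
    eapply Rle_lt_trans; [apply clamp_contract; exact hab | exact Hy].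
Qed.

(** * The iterated-integral operator *)

Lemma continuous_id_mult (h : R -> R) :
  (forall x, continuous h x) -> forall x, continuous (fun tau => tau * h tau) x.
Proof.
  intros Hh x.
  apply (continuous_mult (K := R_AbsRing) (fun y : R => y) h);
    [apply continuous_id | apply Hh].
Qed.

Lemma continuous_conv_pow (m : nat) (t : R) (h : R -> R) :
  (forall x, continuous h x) ->
  forall x, continuous (fun tau => (t - tau) ^ m * h tau) x.
Proof.
  intros Hh x. apply (continuous_mult (K := R_AbsRing) (fun tau => (t - tau) ^ m) h);
    [|apply Hh].
  apply (ex_derive_continuous (fun tau => (t - tau) ^ m)). auto_derive; easy.
Qed.

Lemma ex_RInt_conv_pow (m : nat) (a t u : R) (h : R -> R) :
  (forall x, continuous h x) ->
  ex_RInt (fun tau => (u - tau) ^ m * h tau) a t.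
Proof.
  intros Hh. apply (ex_RInt_continuous (V := R_CompleteNormedModule)).
  intros; now apply continuous_conv_pow.
Qed.

(** Splitting one factor [t - tau] moves the parameter out of the integral:
    this replaces differentiation under the integral sign by the product
    rule. *)
Lemma RInt_conv_pow_S (m : nat) (a t : R) (h : R -> R) :
  (forall x, continuous h x) ->
  RInt (fun tau => (t - tau) ^ S m * h tau) a t =
  t * RInt (fun tau => (t - tau) ^ m * h tau) a t -
  RInt (fun tau => (t - tau) ^ m * (tau * h tau)) a t.
Proof.
  intros Hh.
  assert (Hh' : forall x, continuous (fun tau => tau * h tau) x).
  { now apply continuous_id_mult. }
  apply is_RInt_unique.
  apply (is_RInt_ext
    (fun tau => minus (scal t ((t - tau) ^ m * h tau))
                      ((t - tau) ^ m * (tau * h tau)))).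
  { intros x _. unfold minus, plus, opp, scal; simpl; unfold mult; simpl. ring. }
  apply (is_RInt_minus (V := R_NormedModule)).
  - apply (is_RInt_scal (V := R_NormedModule)),
      (RInt_correct (V := R_CompleteNormedModule)).
    now apply ex_RInt_conv_pow.
  - apply (RInt_correct (V := R_CompleteNormedModule)).
    now apply (ex_RInt_conv_pow m a t t (fun tau => tau * h tau)).
Qed.

Lemma is_derive_RInt_conv_0 (a t : R) (h : R -> R) :
  (forall x, continuous h x) ->
  is_derive (fun u => RInt (fun tau => (u - tau) ^ 0 * h tau) a u) t (h t).
Proof.
  intros Hh.
  apply (is_derive_ext (fun u => RInt h a u)).
  { intros u. apply RInt_ext. intros; simpl; ring. }
  apply (is_derive_RInt h (fun u => RInt h a u) a); [|apply Hh].
  apply filter_forall; intros u.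
  apply (RInt_correct (V := R_CompleteNormedModule)).
  apply (ex_RInt_continuous (V := R_CompleteNormedModule)); auto.
Qed.

Lemma is_derive_id_mult_minus (F G : R -> R) (t dF dG : R) :
  is_derive F t dF -> is_derive G t dG ->
  is_derive (fun u => u * F u - G u) t (F t + t * dF - dG).
Proof.
  intros HF HG.
  evar_last.
  - apply (is_derive_minus (V := R_NormedModule) (fun u => u * F u) G);
      [|exact HG].
    apply (is_derive_mult (K := R_AbsRing) (fun u : R => u) F);
      [apply is_derive_id | exact HF | intros; apply Rmult_comm].
  - unfold minus, plus, opp, mult, one; simpl. ring.
Qed.

(** With [K_m h] the integral with exponent [m], [RInt_conv_pow_S] reads
    [K_(m+1) h = t * K_m h - K_m (tau h)].  Its derivative is [K_m h] plus
    [t * (K_m h)' - (K_m (tau h))'], and this difference is [m * K_m h]: it is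
    [t * h t - t * h t] for [m = 0], and follows otherwise from the induction
    hypothesis and the same identity one level lower.  The induction is over
    all [h] because the hypothesis is applied to [tau * h tau] too. *)
Lemma is_derive_RInt_conv_pow (m : nat) (a t : R) (h : R -> R) :
  (forall x, continuous h x) ->
  is_derive (fun u => RInt (fun tau => (u - tau) ^ S m * h tau) a u) t
    (INR (S m) * RInt (fun tau => (t - tau) ^ m * h tau) a t).
Proof.
  revert h; induction m as [|m IH]; intros h Hh;
    pose proof (continuous_id_mult h Hh) as Hh'.
  - apply (is_derive_ext
      (fun u => u * RInt (fun tau => (u - tau) ^ 0 * h tau) a u -
                RInt (fun tau => (u - tau) ^ 0 * (tau * h tau)) a u)).
    { intros u. symmetry. now apply RInt_conv_pow_S. }
    pose proof (is_derive_RInt_conv_0 a t h Hh) as D0.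
    pose proof (is_derive_RInt_conv_0 a t _ Hh') as D1.
    evar_last; [exact (is_derive_id_mult_minus _ _ _ _ _ D0 D1)|].
    cbn [INR]. ring.
  - apply (is_derive_ext
      (fun u => u * RInt (fun tau => (u - tau) ^ S m * h tau) a u -
                RInt (fun tau => (u - tau) ^ S m * (tau * h tau)) a u)).
    { intros u. symmetry. now apply RInt_conv_pow_S. }
    pose proof (IH h Hh) as D0.
    pose proof (IH _ Hh') as D1.
    evar_last; [exact (is_derive_id_mult_minus _ _ _ _ _ D0 D1)|].
    cbv beta. rewrite (RInt_conv_pow_S m a t h Hh), (S_INR (S m)). ring.
Qed.

Lemma Ck_on_RInt_conv_pow (l m : nat) (a b : R) (h : R -> R) :
  (forall x, continuous h x) -> Ck_on l a b h ->
  Ck_on (l + S m) a b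
    (fun t => RInt (fun tau => (t - tau) ^ m * h tau) a t).
Proof.
  intros Hh Hl. rewrite Nat.add_succ_r.
  induction m as [|m IH].
  - rewrite Nat.add_0_r. exists h; split; [|exact Hl].
    intros x _. apply D_in_of_is_derive. now apply is_derive_RInt_conv_0.
  - exists (fun t => INR (S m) * RInt (fun tau => (t - tau) ^ m * h tau) a t).
    split.
    + intros x _. apply D_in_of_is_derive. now apply is_derive_RInt_conv_pow.
    + rewrite Nat.add_succ_r. apply Ck_on_mult; [apply Ck_on_const | exact IH].
Qed.

(** * Smoothness of phi *)

Lemma nceil_pos (alpha : R) : 0 < alpha -> (0 < nceil alpha)%nat.
Proof.
  intros H. unfold nceil.
  pose proof (Zceil_bound alpha) as B.
  enough (0 < Zceil alpha)%Z by lia.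
  apply lt_IZR. lra.
Qed.

Theorem theorem6 (a b : R) (hab : a < b)
  (alpha : R) (halpha : 0 < alpha)
  (halphaN : forall m : nat, (1 <= m)%nat -> alpha <> INR m)
  (l : nat) (f : R -> R) (hf : Ck_on l a b f)
  (Omega : R -> Prop) (psi : R -> R) (hpsi : admissible Omega psi) :
  forall w : R, Omega w ->
    Ck_on (l + nceil alpha) a b (fun t => phi a alpha psi f t w).
Proof.
  intros w _. unfold phi; cbv zeta.
  set (c := c_coef alpha * _ * _). clearbody c.
  pose proof (nceil_pos alpha halpha) as Hn.
  destruct (nceil alpha) as [|m]; [lia|]. clear Hn.
  replace (S m - 1)%nat with m by lia.
  set (s := psi w).
  set (g := fun tau => exp (s * tau) * f tau).
  assert (Hg : Ck_on l a b g) by (apply Ck_on_mult; [apply Ck_on_exp | exact hf]).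
  set (h := fun tau => g (clamp a b tau)).
  assert (Hgh : forall x, cc a b x -> g x = h x).
  { intros x Hx. unfold h. now rewrite clamp_id. }
  assert (Hh : forall x, continuous h x).
  { apply continuous_comp_clamp; [lra | apply (Ck_on_le 0 l); [lia | exact Hg]]. }
  apply (Ck_on_ext _ a b
    (fun t => c * (exp (- s * t) *
       RInt (fun tau => (t - tau) ^ m * h tau) a t))).
  - intros t Ht. f_equal.
    rewrite <- (RInt_scal (V := R_CompleteNormedModule))
      by now apply ex_RInt_conv_pow.
    apply RInt_ext. intros tau Htau.
    rewrite Rmin_left, Rmax_right in Htau by apply Ht.
    rewrite <- Hgh by (unfold cc in *; lra).
    unfold g, scal; simpl; unfold mult; simpl.
    replace (- (t - tau) * s) with (- s * t + s * tau) by ring.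
    rewrite exp_plus. ring.
  - apply Ck_on_mult; [apply Ck_on_const|].
    apply Ck_on_mult; [apply Ck_on_exp|].
    apply Ck_on_RInt_conv_pow; [exact Hh|].
    exact (Ck_on_ext _ _ _ _ _ Hgh Hg).
Qed.
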